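(* Let $\alpha\ge\beta>-1$, let $k\ge 1$ be an integer, and let $x_m$ and $x_M$ be the least and the largest zero, respectively, of the Jacobi polynomial $P_k^{(\alpha,\beta)}(x)$. Then $$x_m>y_1+3(1-y_1^2)^{2/3}(2R)^{-1/3},$$ $$x_M<y_2-3(1-y_2^2)^{2/3}(2R)^{-1/3}+\frac{4q(s+1)}{(r^2+2s+1)^{3/2}},$$ where $$s=\alpha+\beta+1,\quad q=\alpha-\beta,\quad r=2k+\alpha+\beta+1,\quad R=\sqrt{(r^2-q^2+2s+1)(r^2-s^2)},$$ and $$y_1=-\frac{R+q(s+1)}{r^2+2s+1},\qquad y_2=\frac{R-q(s+1)}{r^2+2s+1}.$$
   Context: For $\alpha,\beta>-1$, the Jacobi polynomials $P_k^{(\alpha,\beta)}(x)$ (of degree $k$) are the polynomials orthogonal on $[-1,1]$ with respect to the weight function $(1-x)^\alpha(1+x)^\beta$. *)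

(* Defs.v *)
From HB Require Import structures.
From mathcomp Require Import all_boot all_order all_algebra.
From mathcomp Require Import all_classical all_reals all_analysis.

Set Implicit Arguments.
Unset Strict Implicit.
Unset Printing Implicit Defensive.

Import Order.TTheory GRing.Theory Num.Theory.
Local Open Scope classical_set_scope.
Local Open Scope ring_scope.

(* At the endpoints [powR] takes conventional values ([0 `^ a = 0] for
   [a != 0]); this only affects a null set. *)
Definition jacobi_weight (K : realType) (alpha beta x : K) : K :=
  (1 - x) `^ alpha * (1 + x) `^ beta.

(* Jacobi polynomials are only determined up to a nonzero factor in each
   degree; no normalization is imposed.  For [alpha, beta > -1] the integrands
   below are integrable. *)
Definition jacobi_polynomials (K : realType) (alpha beta : K)
    (P : nat -> {poly K}) : Prop :=
  (forall n : nat, size (P n) = n.+1) /\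
  (forall m n : nat, m <> n ->
    (\int[lebesgue_measure]_(x in `[(-1)%R, 1%R])
       (((P m).[x] * (P n).[x] * jacobi_weight alpha beta x)%:E) = 0)%E).

Definition least_zero (K : realType) (p : {poly K}) (x : K) : Prop :=
  root p x /\ forall y : K, root p y -> x <= y.

Definition largest_zero (K : realType) (p : {poly K}) (x : K) : Prop :=
  root p x /\ forall y : K, root p y -> y <= x.

(* Main.v *)
Require Import Defs.
From HB Require Import structures.
From mathcomp Require Import all_boot all_order all_algebra.
From mathcomp Require Import all_classical all_reals all_analysis.
From mathcomp Require Import measurable_realfun real_interval.
From mathcomp Require Import ring lra zify.

(** Let [f = P k].  Integration by parts shows that [f] satisfies the Jacobi
    equation [(1 - x^2) f'' - (q + (s + 1) x) f' + lam f = 0] with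
    [4 lam = r^2 - s^2], and orthogonality to all lower degrees puts all roots
    of [f] in the open interval ]-1, 1[.

    To the right of the largest zero [z], the logarithmic derivative [f' / f]
    decreases from [+oo] to a finite value at [1], whereas
    [(q + (s + 1) x) / (2 (1 - x^2))] tends to [+oo] at [1]; so the two agree at
    some [x] in ]z, 1[ ([critical_point_right]).  As all roots are real,
    [f'^2 - f f'' = f^2 * sum_y 1 / (x - y)^2 >= f^2 / (x - z)^2], [y] ranging
    over the roots.  Eliminating [f''] by the equation and [f'] by the choice of
    [x] leaves an inequality free of [f] ([extreme_zero_ineq]):
    [4 (1 - x^2)^2 <= (x - z)^2 (4 lam (1 - x^2) - (q + (s + 1) x)^2)].
    The quadratic on the right is [A (y2 - x) (x - y1)] with
    [A = r^2 + 2 s + 1] ([jacobi_turning_points]).  Hence [x] lies between [y1]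
    and [y2], and with [h = y2 - x]
    [[
      y2 - z >= h + 2 (1 - x^2) / sqrt (A h (x - y1)).
    ]]
    Replacing [x - y1] by [y2 - y1] and [1 - x^2] by [w = 1 - y2^2] gives
    [h + 2 w / sqrt (2 R h)], whose minimum over [h > 0] is exactly
    [3 w^(2/3) (2 R)^(-1/3)] by the inequality between arithmetic and geometric
    means ([amgm_powR]).

    This replacement is legitimate when the turning point next to the zero is
    the one farther from the origin, which is [y1] as [q >= 0];
    the reflection [x -> - x, q -> - q] turns the least zero into this case
    ([zero_bound_far]).  For the largest zero [1 - x^2] may be smaller than [w],
    and the defect is bounded by the last summand of the statement
    ([zero_bound_near]). *)

Set Implicit Arguments.
Unset Strict Implicit.
Unset Printing Implicit Defensive.

Import Order.TTheory GRing.Theory Num.Theory.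
Import numFieldNormedType.Exports.
Local Open Scope ring_scope.

(** * Bounds on a point below a turning point *)

(** With [g = w / sqrt (B h)] the right-hand side is [h + 2 g], whereas
    [h g^2 = w^2 / B]; so the cube of the claim is [27 h g^2 <= (h + 2 g)^3], and
    the difference of both sides is [(h - g)^2 (h + 8 g)]. *)
Lemma amgm_powR (K : realType) (h w B : K) : 0 < h -> 0 < w -> 0 < B ->
  3 * w `^ (2 / 3) * B `^ (- (1 / 3)) <= h + 2 * w / Num.sqrt (B * h).
Proof.
move=> h0 w0 B0.
set T := _ * B `^ _; set S := Num.sqrt _.
have S0 : 0 < S by rewrite sqrtr_gt0 mulr_gt0.
have S2 : S ^+ 2 = B * h by rewrite sqr_sqrtr// ltW// mulr_gt0.
have T0 : 0 <= T by rewrite !mulr_ge0// ?powR_ge0.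
have T3 : T ^+ 3 = 27 * w ^+ 2 / B.
  have cube (a e e' : K) : e * 3 = e' -> (a `^ e) ^+ 3 = a `^ e'.
    by move=> <-; rewrite -powR_mulrn ?powR_ge0// -powRrM.
  rewrite /T !exprMn (@cube w _ 2) 1?(@cube B _ (-1)); [|by field|by field].
  rewrite (powR_mulrn 2 (ltW w0)) (powR_inv1 (ltW B0)).
  by congr (_ * _ * _); ring.
have g0 : 0 < w / S by rewrite divr_gt0.
have hg : h * (w / S) ^+ 2 = w ^+ 2 / B.
  by rewrite expr_div_n S2; field; rewrite !gt_eqF.
have S'0 : 0 <= h + 2 * w / S by rewrite -mulrA; lra.
rewrite -(ler_pXn2r (isT : (0 < 3)%N)) ?nnegrE//.
rewrite T3 -(mulrA 27) -hg -(mulrA 2); set g := w / S in g0 *.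
have : 0 <= (h - g) ^+ 2 * (h + 8 * g) by rewrite mulr_ge0 ?sqr_ge0//; lra.
by lra.
Qed.

(** The hypothesis makes [(y2 - x) (x - y1)] positive, which places [x] between
    the turning points; the rest is the square root of the hypothesis. *)
Lemma turning_point_gap (K : realType) (A y1 y2 x z : K) :
  0 < A -> -1 < x < 1 -> z < x -> y1 < y2 ->
  4 * (1 - x ^+ 2) ^+ 2 <= (x - z) ^+ 2 * (A * (y2 - x) * (x - y1)) ->
  [/\ y1 < x, x < y2 &
   2 * (1 - x ^+ 2) <=
     (x - z) * (Num.sqrt A * Num.sqrt (y2 - x) * Num.sqrt (x - y1))].
Proof.
move=> A0 /andP[xm1 x1] zx y12 H.
have x2 : 0 < 1 - x ^+ 2 by nra.
have hv : 0 < (y2 - x) * (x - y1).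
  have /pmulr_rgt0 <- : 0 < (x - z) ^+ 2 * A by rewrite mulr_gt0 ?exprn_gt0 ?subr_gt0.
  apply: lt_le_trans (_ : 0 < 4 * (1 - x ^+ 2) ^+ 2) _; last by lra.
  by rewrite mulr_gt0 ?exprn_gt0.
have y1x : y1 < x by nra.
have xy2 : x < y2 by nra.
split=> //.
rewrite -ler_sqr ?nnegrE; last 2 first.
- by lra.
- by rewrite !mulr_ge0 ?sqrtr_ge0//; lra.
rewrite !exprMn !sqr_sqrtr ?subr_ge0 ?(ltW A0) ?(ltW y1x) ?(ltW xy2)//.
by rewrite (_ : 2 ^+ 2 = 4); [lra|ring].
Qed.

(** [y1 + y2 >= 0] means that [y2] is the turning point farther from the origin,
    so that [1 - x^2 > 1 - y2^2] for every [x] between the turning points. *)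
Lemma zero_bound_far (K : realType) (A y1 y2 x z : K) :
  0 < A -> -1 < x < 1 -> z < x -> y1 < y2 < 1 -> -1 < y1 -> 0 <= y1 + y2 ->
  4 * (1 - x ^+ 2) ^+ 2 <= (x - z) ^+ 2 * (A * (y2 - x) * (x - y1)) ->
  z < y2 - 3 * (1 - y2 ^+ 2) `^ (2 / 3) * (A * (y2 - y1)) `^ (- (1 / 3)).
Proof.
move=> A0 x11 zx /andP[y12 y21] y1m1 y0 H.
have [y1x xy2 {}H] := turning_point_gap A0 x11 zx y12 H.
have w0 : 0 < 1 - y2 ^+ 2 by nra.
have h0 : 0 < y2 - x by lra.
have D0 : 0 < y2 - y1 by lra.
have := amgm_powR h0 w0 (mulr_gt0 A0 D0).
set T := _ * _ `^ _.
rewrite !sqrtrM ?mulr_ge0 ?(ltW A0) ?(ltW D0)//.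
move: H; set a := Num.sqrt A; set u := Num.sqrt (y2 - x).
set v := Num.sqrt (x - y1); set d := Num.sqrt (y2 - y1) => H HT.
have a0 : 0 < a by rewrite sqrtr_gt0.
have u0 : 0 < u by rewrite sqrtr_gt0.
have v0 : 0 < v by rewrite sqrtr_gt0 subr_gt0.
have vd : v < d by rewrite ltr_sqrt//; lra.
have xw : 1 - y2 ^+ 2 < 1 - x ^+ 2 by nra.
have Hx : 2 * (1 - x ^+ 2) / (a * u * v) <= x - z.
  by rewrite ler_pdivrMr ?mulr_gt0.
suff : 2 * (1 - y2 ^+ 2) / (a * d * u) < 2 * (1 - x ^+ 2) / (a * u * v) by lra.
apply: (@lt_trans _ _ (2 * (1 - y2 ^+ 2) / (a * u * v))); last first.
  by rewrite ltr_pM2r ?invr_gt0 ?mulr_gt0//; lra.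
rewrite ltr_pM2l ?mulr_gt0// ltf_pV2 ?posrE ?mulr_gt0//; last exact: lt_trans vd.
by rewrite mulrAC ltr_pM2r// ltr_pM2l.
Qed.

(** Put [h = y2 - x = u^2], [x - y1 = v^2], [y2 - y1 = u^2 + v^2 = d^2] and
    [- (y1 + y2) = 2 C].  Then [1 - x^2 = w + u^2 v^2 - 2 C u^2] with
    [w = 1 - y2^2], and only the summand [- 2 C u^2] can be harmful.  For
    [u <= v] it costs at most [4 C / sqrt A].  For [u > v] it costs more, but
    then the gain from [v < d] compensates, because [1 - y1^2 > 0] means
    [w > 2 C d^2]. *)
Lemma zero_bound_near (K : realType) (A y1 y2 x z : K) :
  0 < A -> -1 < x < 1 -> z < x -> y1 < y2 < 1 -> -1 < y1 -> y1 + y2 <= 0 ->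
  4 * (1 - x ^+ 2) ^+ 2 <= (x - z) ^+ 2 * (A * (y2 - x) * (x - y1)) ->
  z < y2 - 3 * (1 - y2 ^+ 2) `^ (2 / 3) * (A * (y2 - y1)) `^ (- (1 / 3))
      - 2 * (y1 + y2) / Num.sqrt A.
Proof.
move=> A0 x11 zx /andP[y12 y21] y1m1 y0 H.
have [y1x xy2 {}H] := turning_point_gap A0 x11 zx y12 H.
have w0 : 0 < 1 - y2 ^+ 2 by nra.
have h0 : 0 < y2 - x by lra.
have D0 : 0 < y2 - y1 by lra.
have := amgm_powR h0 w0 (mulr_gt0 A0 D0).
set T := _ * _ `^ _.
rewrite !sqrtrM ?mulr_ge0 ?(ltW A0) ?(ltW D0)//.
have u2 : Num.sqrt (y2 - x) ^+ 2 = y2 - x by rewrite sqr_sqrtr// ltW.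
have v2 : Num.sqrt (x - y1) ^+ 2 = x - y1 by rewrite sqr_sqrtr// ltW ?subr_gt0.
have d2 : Num.sqrt (y2 - y1) ^+ 2 = y2 - y1 by rewrite sqr_sqrtr// ltW.
move: H u2 v2 d2; set a := Num.sqrt A; set u := Num.sqrt (y2 - x).
set v := Num.sqrt (x - y1); set d := Num.sqrt (y2 - y1) => H u2 v2 d2 HT.
have a0 : 0 < a by rewrite sqrtr_gt0.
have u0 : 0 < u by rewrite sqrtr_gt0.
have v0 : 0 < v by rewrite sqrtr_gt0 subr_gt0.
have vd : v < d by rewrite ltr_sqrt//; lra.
have ud : u < d by rewrite ltr_sqrt//; lra.
have Hx : 2 * (1 - x ^+ 2) / (a * u * v) <= x - z.
  by rewrite ler_pdivrMr ?mulr_gt0.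
have d0 : 0 < d by exact: lt_trans vd.
pose C := - (y1 + y2) / 2.
have C0 : 0 <= C by rewrite /C; lra.
have wE : 1 - x ^+ 2 = (1 - y2 ^+ 2) + u ^+ 2 * v ^+ 2 - 2 * C * u ^+ 2.
  by rewrite /C u2 v2; field.
have wC : 2 * C * d ^+ 2 < 1 - y2 ^+ 2.
  by rewrite /C d2; nra.
suff key : 2 * (1 - y2 ^+ 2) / (a * d * u) - 4 * C / a
           < 2 * (1 - x ^+ 2) / (a * u * v).
  have : 4 * C / a = - (2 * (y1 + y2) / a) by rewrite /C; field; rewrite gt_eqF.
  by lra.
rewrite wE -subr_gt0.
move: wC; move: (1 - y2 ^+ 2) w0 => w w0 wC.
(* All terms below are nonnegative but [2 * C * (u * d * (v - u))], which is
   absorbed by [w * (d - v)] thanks to [d * (d - v) >= u * (u - v)]. *)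
rewrite (_ : _ - _ = 2 / (a * u * v * d) *
   (w * (d - v) + u ^+ 2 * v ^+ 2 * d + 2 * C * (u * d * (v - u)))); last first.
  by field; rewrite !gt_eqF.
apply: mulr_gt0; first by rewrite divr_gt0 ?mulr_gt0.
have uvd : 0 < u ^+ 2 * v ^+ 2 * d by rewrite !mulr_gt0 ?exprn_gt0.
have dv : 0 < d - v by lra.
have wdv : 0 <= (w - 2 * C * d ^+ 2) * (d - v) by rewrite mulr_ge0//; lra.
have : 0 <= 2 * C * (d * (d * (d - v) + u * (v - u))).
  by rewrite mulr_ge0 ?mulr_ge0 ?(ltW d0)//; nra.
lra.
Qed.

(** * Real-rooted solutions of the Jacobi equation *)

Definition jacobi_op (K : realType) (s q : K) (f : {poly K}) : {poly K} :=
  (1 - 'X ^+ 2) * f^`()^`() - (q%:P + (s + 1)%:P * 'X) * f^`().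

Section ProductsOfLinearFactors.
Variable K : realType.
Implicit Types (rs : seq K) (p g : {poly K}) (x z : K).

(** Away from the roots [y] of a real-rooted [p], this is [p^2] times the sum of
    the [1 / (x - y)^2]. *)
Definition laguerre p x := p^`().[x] ^+ 2 - p.[x] * p^`()^`().[x].

Lemma laguerre_linear_factor z g x :
  laguerre (('X - z%:P) * g) x = g.[x] ^+ 2 + (x - z) ^+ 2 * laguerre g x.
Proof.
rewrite /laguerre !(derivM, derivXsubC, mul1r) derivD derivM derivXsubC mul1r.
by rewrite !(hornerXsubC, hornerD, hornerM); ring.
Qed.

Lemma laguerre_ge0 rs x : 0 <= laguerre (\prod_(z <- rs) ('X - z%:P)) x.
Proof.
elim: rs => [|z rs IH]; first
  by rewrite big_nil /laguerre -polyC1 !derivC !hornerE expr0n/= subr0.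
rewrite big_cons laguerre_linear_factor.
by apply: addr_ge0; [exact: sqr_ge0|rewrite mulr_ge0 ?sqr_ge0].
Qed.

Lemma prodXsubC_gt0 rs x : (forall z, z \in rs -> z < x) ->
  0 < (\prod_(z <- rs) ('X - z%:P)).[x].
Proof.
move=> h; rewrite horner_prod big_seq prodr_gt0// => z /h zx.
by rewrite hornerXsubC subr_gt0.
Qed.

Lemma deriv_prodXsubC_ge0 rs x : (forall z, z \in rs -> z < x) ->
  0 <= (\prod_(z <- rs) ('X - z%:P))^`().[x].
Proof.
elim: rs => [_|z rs IH h]; first by rewrite big_nil derivC horner0.
have hz : z < x by rewrite h ?mem_head.
have hs y : y \in rs -> y < x by move=> ?; rewrite h// in_cons orbC; apply/orP; left.
rewrite big_cons derivM derivXsubC mul1r !hornerE.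
by rewrite addr_ge0 ?(ltW (prodXsubC_gt0 hs)) ?mulr_ge0 ?IH// subr_ge0 ltW.
Qed.

(** The intermediate value theorem applies to the difference [psi] of the two
    sides: at [1] only the right-hand side survives, and it is positive there;
    near [z] the left-hand side dominates, because [f' / f >= 1 / (x - z)]. *)
Lemma critical_point_right (s q : K) rs z : `|q| < s + 1 -> z \in rs ->
  (forall y, y \in rs -> -1 < y <= z) -> z < 1 ->
  let f := \prod_(y <- rs) ('X - y%:P) in
  exists2 x, z < x < 1 &
    2 * (1 - x ^+ 2) * f^`().[x] = (q + (s + 1) * x) * f.[x].
Proof.
rewrite ltr_norml => /andP[qs1 qs2] zrs hrs z1 f.
have /andP[zm1 _] := hrs _ zrs.
(* A point so close to [z] that [2 (1 - x0^2) >= 2 (s + 1) (x0 - z)]: with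
   [x0 - z = (1 - z) t] this follows from [(1 - t) (1 + z) = (s + 1) t]. *)
pose t := (1 + z) / (1 + z + (s + 1)).
have den0 : 0 < 1 + z + (s + 1) by lra.
have t0 : 0 < t by rewrite divr_gt0//; lra.
have tE : t * (1 + z + (s + 1)) = 1 + z by rewrite /t divfK ?gt_eqF.
have t1 : t < 1 by rewrite ltr_pdivrMr//; lra.
pose x0 := z + (1 - z) * t.
have zx0 : z < x0 by rewrite ltrDl mulr_gt0// subr_gt0.
have x01 : x0 < 1 by rewrite /x0; nra.
pose psi := (q%:P + (s + 1)%:P * 'X) * f - (2%:P * (1 - 'X ^+ 2)) * f^`().
have psiE x : psi.[x] =
    (q + (s + 1) * x) * f.[x] - 2 * (1 - x ^+ 2) * f^`().[x].
  by rewrite /psi !hornerE.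
have f_gt0 x : z < x -> 0 < f.[x].
  by move=> zx; apply: prodXsubC_gt0 => y /hrs /andP[_ yz]; exact: le_lt_trans zx.
have psi1 : 0 < psi.[1].
  rewrite psiE expr1n subrr mulr0 mul0r subr0 mulr1.
  by rewrite mulr_gt0 ?f_gt0//; lra.
have psi0 : psi.[x0] <= 0.
  rewrite psiE /f (big_rem z zrs) /=; set g := \prod_(y <- _) _.
  have hg y : y \in rem z rs -> y < x0.
    by move=> /mem_rem /hrs /andP[_ yz]; exact: le_lt_trans zx0.
  have g0 := prodXsubC_gt0 hg; have g1 := deriv_prodXsubC_ge0 hg.
  rewrite -/g in g0 g1.
  rewrite derivM derivXsubC mul1r !(hornerXsubC, hornerD, hornerM).
  have x02 : 0 <= 1 - x0 ^+ 2 by nra.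
  have b0 : 0 <= 2 * (1 - x0 ^+ 2) * ((x0 - z) * g^`().[x0]).
    by rewrite !mulr_ge0// subr_ge0 ltW.
  suff : 0 <= (2 * (1 - x0 ^+ 2) - (q + (s + 1) * x0) * (x0 - z)) * g.[x0].
    by lra.
  rewrite mulr_ge0 ?(ltW g0)//.
  have e1 : (1 - t) * (1 + z) = (s + 1) * t by lra.
  have h1 : (q + (s + 1) * x0) * (x0 - z) <= 2 * (s + 1) * (x0 - z).
    by rewrite ler_wpM2r ?subr_ge0 ?(ltW zx0)//; nra.
  have h2 : (1 - x0) * (1 + z) <= 1 - x0 ^+ 2 by nra.
  have : (1 - x0) * (1 + z) = (1 - z) * ((1 - t) * (1 + z)) by rewrite /x0; ring.
  rewrite e1 => h3.
  have : x0 - z = (1 - z) * t by rewrite /x0; ring.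
  by move=> e4; rewrite e4 in h1 *; lra.
have [x /andP[x0x x1] /rootP rx] :=
  @poly_ivt _ psi _ _ (ltW x01) (introT andP (conj psi0 (ltW psi1))).
exists x; last by move: rx; rewrite psiE; lra.
rewrite (lt_le_trans zx0 x0x) lt_neqAle x1 andbT.
by apply: contra_ltN psi1 => /eqP <-; rewrite rx.
Qed.

(** At the point given by [critical_point_right], the product of [laguerre f x]
    with [4 (1 - x^2)^2] is [f x ^ 2] times the quadratic on the right, and
    splitting off the factor ['X - z] bounds [laguerre f x] below by
    [(f x / (x - z))^2]. *)
Lemma extreme_zero_ineq (s q lam : K) rs z : `|q| < s + 1 -> z \in rs ->
  (forall y, y \in rs -> -1 < y <= z) -> z < 1 ->
  let f := \prod_(y <- rs) ('X - y%:P) in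
  jacobi_op s q f + lam *: f = 0 ->
  exists2 x, z < x < 1 &
    4 * (1 - x ^+ 2) ^+ 2 <=
    (x - z) ^+ 2 * (4 * lam * (1 - x ^+ 2) - (q + (s + 1) * x) ^+ 2).
Proof.
move=> qs zrs hrs z1 f ode.
have [x /andP[zx x1] xcrit] := critical_point_right qs zrs hrs z1.
exists x; first by rewrite zx.
have /= odex : (1 - x ^+ 2) * f^`()^`().[x] =
    (q + (s + 1) * x) * f^`().[x] - lam * f.[x].
  have := congr1 (horner^~ x) ode.
  rewrite /jacobi_op.
  by rewrite !(hornerD, hornerN, hornerM, hornerZ, hornerX, hornerXn, hornerC); lra.
have fE : f = ('X - z%:P) * \prod_(y <- rem z rs) ('X - y%:P).
  by rewrite /f (big_rem z zrs).
have Lf : (\prod_(y <- rem z rs) ('X - y%:P)).[x] ^+ 2 <= laguerre f x.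
  by rewrite fE laguerre_linear_factor lerDl mulr_ge0 ?sqr_ge0 ?laguerre_ge0.
have fx : f.[x] = (x - z) * (\prod_(y <- rem z rs) ('X - y%:P)).[x].
  by rewrite fE hornerM hornerXsubC.
have f0 : 0 < f.[x].
  by apply: prodXsubC_gt0 => y /hrs /andP[_ yz]; exact: le_lt_trans zx.
have LE : 4 * (1 - x ^+ 2) ^+ 2 * laguerre f x =
  f.[x] ^+ 2 * (4 * lam * (1 - x ^+ 2) - (q + (s + 1) * x) ^+ 2).
  rewrite /laguerre mulrBr.
  rewrite (_ : _ - _ = (2 * (1 - x ^+ 2) * f^`().[x]) ^+ 2 -
     4 * (1 - x ^+ 2) * f.[x] * ((1 - x ^+ 2) * f^`()^`().[x])); last by ring.
  rewrite odex xcrit (_ : 4 * (1 - x ^+ 2) * f.[x] * _ =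
    2 * f.[x] * ((q + (s + 1) * x) * (2 * (1 - x ^+ 2) * f^`().[x]) -
                 2 * (1 - x ^+ 2) * (lam * f.[x]))); last by ring.
  by rewrite xcrit; ring.
rewrite -(ler_pM2l (exprn_gt0 2 f0)) [leRHS]mulrCA -LE {1}fx exprMn -[leLHS]mulrA.
apply: ler_wpM2l; first exact: sqr_ge0.
by rewrite mulrC; apply: ler_wpM2l => //; rewrite mulr_ge0 ?sqr_ge0.
Qed.
End ProductsOfLinearFactors.

(** * Polynomials orthogonal for a positive functional *)

Section OrthogonalPolynomials.
Variables (K : realType) (L : {scalar {poly K}}) (P : nat -> {poly K}).
Hypothesis L_neq0 : forall p, p != 0 ->
  (forall x, -1 < x < 1 -> 0 <= p.[x]) -> L p != 0.
Hypothesis sizeP : forall n, size (P n) = n.+1.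
Hypothesis orthP : forall m n, m <> n -> L (P m * P n) = 0.

Lemma orthogonal_lower_degree n (g : {poly K}) : (size g <= n)%N -> L (P n * g) = 0.
Proof.
suff H m : (m <= n)%N -> forall g : {poly K}, (size g <= m)%N -> L (P n * g) = 0.
  exact: H.
elim: m => [_ {}g sg|m IH mn {}g sg].
  by move: sg; rewrite leqn0 size_poly_eq0 => /eqP ->; rewrite mulr0 linear0.
have lc0 : lead_coef (P m) != 0 by rewrite lead_coef_eq0 -size_poly_eq0 sizeP.
pose c := g`_m / lead_coef (P m).
rewrite -[g](subrK (c *: P m)) mulrDr raddfD /= -scalerAr [L (_ *: _)]linearZ /=.
rewrite (@orthP n m) => [|nm]; last by rewrite nm ltnn in mn.
rewrite mulr0 addr0 IH ?(ltnW mn)//.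
apply/leq_sizeP => j; rewrite coefB coefZ leq_eqVlt => /predU1P[<-|mj].
  by rewrite (_ : (P m)`_m = lead_coef (P m)) ?divfK ?subrr// lead_coefE sizeP.
by rewrite !nth_default ?mulr0 ?subrr ?sizeP// (leq_trans sg).
Qed.

Lemma no_root_constant_sign (h : {poly K}) :
  (forall x, -1 < x < 1 -> ~~ root h x) ->
  (forall x, -1 < x < 1 -> 0 <= h.[x]) \/ (forall x, -1 < x < 1 -> 0 <= (- h).[x]).
Proof.
move=> hr.
have no_change a b : -1 < a < 1 -> -1 < b < 1 -> h.[a] < 0 -> h.[b] < 0.
  move=> /andP[a1 a2] /andP[b1 b2] ha; rewrite ltNge; apply/negP => hb.
  have [ab|/ltW ba] := leP a b.
    have [|y /andP[ay yb]] := @poly_ivt _ h _ _ ab; first by rewrite (ltW ha).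
    by apply/negP/hr; lra.
  have [|y /andP[by1 ya]] := @poly_ivt _ (- h) _ _ ba.
    by rewrite !hornerN oppr_le0 hb oppr_ge0 ltW.
  by rewrite rootN; apply/negP/hr; lra.
have [h0|h0] := ltP h.[0] 0; [right|left] => x x11.
  by rewrite hornerN oppr_ge0 ltW// (no_change 0)//; lra.
by rewrite leNgt; apply: contraL h0 => hx; rewrite -ltNge (no_change x)//; lra.
Qed.

Lemma split_roots_in_interval (p : {poly K}) : p != 0 ->
  exists rs h, [/\ p = h * \prod_(z <- rs) ('X - z%:P),
    forall z, z \in rs -> -1 < z < 1 &
    forall x, -1 < x < 1 -> ~~ root h x].
Proof.
move: {2}(size p) (leqnn (size p)) => n; elim: n p => [|n IH] p pn p0.
  by move: pn p0; rewrite leqn0 size_poly_eq0 => ->.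
have [[z [z11 rz]]|nr] := pselect (exists z, -1 < z < 1 /\ root p z); last first.
  exists [::], p; split => //; first by rewrite big_nil mulr1.
  by move=> x x11; apply/negP => rx; apply: nr; exists x.
have /factor_theorem [p' pE] := rz.
have p'0 : p' != 0 by apply: contraNneq p0 => p'0; rewrite pE p'0 mul0r.
have [|//|rs [h [p'E rs11 hr]]] := IH p'.
  by move: pn; rewrite pE size_Mmonic ?monicXsubC// size_XsubC addn2.
exists (z :: rs), h; split => //; first by rewrite big_cons pE p'E mulrA mulrAC -mulrA.
by move=> y; rewrite in_cons => /predU1P[->//|/rs11].
Qed.

(** Let [f] be the product of the ['X - z] over the roots of [P k] in ]-1, 1[,
    counted with multiplicity.  Then [P k * f] is the square of [f] times a
    polynomial of constant sign, so [L (P k * f)] is nonzero, and [f] cannot have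
    degree less than [k]. *)
Lemma orthogonal_roots_in_interval k :
  exists c rs, [/\ c != 0, P k = c *: \prod_(z <- rs) ('X - z%:P) &
    forall z, z \in rs -> -1 < z < 1].
Proof.
have Pk0 : P k != 0 by rewrite -size_poly_eq0 sizeP.
have [rs [h [PE rs11 hr]]] := split_roots_in_interval Pk0.
set f := \prod_(z <- rs) _ in PE.
have f0 : f != 0 by apply: contraNneq Pk0 => f0; rewrite PE f0 mulr0.
have h0 : h != 0 by apply: contraNneq Pk0 => h0; rewrite PE h0 mul0r.
have fmon : f \is monic by exact: monic_prod_XsubC.
have [sf|sf] := leqP (size f) k.
  have := orthogonal_lower_degree sf; rewrite {1}PE -mulrA => Lhff.
  have ff0 : h * (f * f) != 0 by rewrite !mulf_neq0.
  have [hp|hp] := no_root_constant_sign hr.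
    suff /(L_neq0 ff0) : forall x, -1 < x < 1 -> 0 <= (h * (f * f)).[x].
      by rewrite Lhff eqxx.
    by move=> x /hp hx; rewrite !hornerM mulr_ge0// -expr2 sqr_ge0.
  have nff0 : - h * (f * f) != 0 by rewrite mulNr oppr_eq0.
  suff /(L_neq0 nff0) : forall x, -1 < x < 1 -> 0 <= (- h * (f * f)).[x].
    by rewrite mulNr raddfN /= Lhff oppr0 eqxx.
  by move=> x /hp hx; rewrite !hornerM mulr_ge0// -expr2 sqr_ge0.
have sh : size h = 1%N.
  have := sizeP k; rewrite PE size_Mmonic// => shf.
  have : (0 < size h)%N by rewrite lt0n size_poly_eq0.
  by move: sf shf; set a := size _; set b := size _ => sf shf h_pos; lia.
have /size_poly1P[c c0 hE] : size h == 1%N by rewrite sh.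
by exists c, rs; split => //; rewrite PE hE mul_polyC.
Qed.

Section JacobiOperator.
Variables (s q : K).
(** This is the integrated form of the Pearson equation
    [((1 - x^2) w)' = - (q + (s + 1) x) w] of the weight [w]. *)
Hypothesis L_pearson : forall p,
  L ((1 - 'X ^+ 2) * p^`() - (q%:P + (s + 1)%:P * 'X) * p) = 0.

Lemma jacobi_op_byparts f g :
  L (jacobi_op s q f * g) = - L ((1 - 'X ^+ 2) * f^`() * g^`()).
Proof.
apply/eqP; rewrite -addr_eq0 -linearD /=; apply/eqP.
rewrite -[RHS](L_pearson (f^`() * g)) /jacobi_op derivM; congr (L _).
by ring.
Qed.

Lemma jacobi_op_symmetric f g : L (jacobi_op s q f * g) = L (f * jacobi_op s q g).
Proof.
by rewrite [f * _]mulrC !jacobi_op_byparts; congr (- L _); ring.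
Qed.

Lemma size_jacobi_op f : (size (jacobi_op s q f) <= size f)%N.
Proof.
have d0 (p : {poly K}) : p^`() != 0 -> (size p^`() < size p)%N.
  by move=> p'0; apply: lt_size_deriv; apply: contraNneq p'0 => ->; rewrite deriv0.
have s2 : (size (1 - 'X ^+ 2 : {poly K})%R <= 3)%N.
  by rewrite (leq_trans (size_polyD _ _))// geq_max size_poly1 size_polyN size_polyXn.
have s1 : (size (q%:P + (s + 1)%:P * 'X : {poly K})%R <= 2)%N.
  by rewrite addrC size_MXaddC; case: ifP => // _; rewrite ltnS size_polyC_leq1.
rewrite /jacobi_op (leq_trans (size_polyD _ _))// geq_max size_polyN.
have mul (p g : {poly K}) n : (size p <= n.+1)%N -> (size g + n <= size f)%N ->
    (size (p * g)%R <= size f)%N.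
  move=> pn gn; rewrite (leq_trans (size_polyMleq _ _))// (leq_trans _ gn)//.
  by rewrite addnC -subn1 leq_subLR addnCA leq_add2l add1n.
have [f'0|/d0 f'f] := eqVneq f^`() 0.
  by rewrite f'0 deriv0 !mulr0 size_poly0.
apply/andP; split; last by rewrite (mul _ _ 1%N) ?addn1.
have [f''0|/d0 f''f'] := eqVneq f^`()^`() 0.
  by rewrite f''0 mulr0 size_poly0.
by rewrite (mul _ _ 2)// addn2 (leq_trans _ f'f).
Qed.

(** The operator multiplies the leading coefficient by [- k (k + s)]. *)
Lemma size_jacobi_op_lead k (f : {poly K}) : size f = k.+1 ->
  (size (jacobi_op s q f + (k%:R * (k%:R + s)) *: f)%R <= k)%N.
Proof.
move=> sf; pose c := f`_k.
have [g [fE sg]] : exists g, f = c *: 'X^k + g /\ (size g <= k)%N.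
  exists (f - c *: 'X^k); split; first by rewrite addrC subrK.
  apply/leq_sizeP => j; rewrite coefB coefZ coefXn leq_eqVlt => /predU1P[<-|kj].
    by rewrite eqxx mulr1 subrr.
  by rewrite gtn_eqF// mulr0 subr0 nth_default// sf.
have -> : jacobi_op s q f + (k%:R * (k%:R + s)) *: f =
  c *: (jacobi_op s q 'X^k + (k%:R * (k%:R + s)) *: 'X^k) +
  (jacobi_op s q g + (k%:R * (k%:R + s)) *: g).
  rewrite fE /jacobi_op !(derivD, derivZ) -!mul_polyC; ring.
rewrite (leq_trans (size_polyD _ _))// geq_max.
apply/andP; split; last first.
  rewrite (leq_trans (size_polyD _ _))// geq_max (leq_trans (size_jacobi_op _))//.
  by rewrite (leq_trans (size_scale_leq _ _)).
rewrite (leq_trans (size_scale_leq _ _))//.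
have natP n (p : {poly K}) : p *+ n = n%:R%:P * p.
  by rewrite polyC_natr mulr_natl.
have -> : jacobi_op s q 'X^k + (k%:R * (k%:R + s)) *: 'X^k =
   (k%:R * (k%:R - 1)) *: 'X^(k.-2) - (q * k%:R) *: 'X^(k.-1).
  rewrite /jacobi_op !derivXn derivMn derivXn -!mul_polyC !natP.
  case: k {sf sg fE c} => [|[|k]]; rewrite /= ?expr0 ?expr1.
  - by rewrite !mul0r; ring.
  - by rewrite mul0r; ring.
  have k2 : k.+2%:R = k.+1%:R + 1 :> K by rewrite natr1.
  rewrite k2 (exprS 'X k.+1) (exprS 'X k).
  move: ('X^k) (k.+1%:R : K) => Y a.
  rewrite !(polyCM, polyCD, polyCN) addrK; ring.
rewrite (leq_trans (size_polyD _ _))// size_polyN geq_max.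
case: k {sf sg fE c} => [|k]; first by rewrite mul0r mulr0 !scale0r size_poly0.
by rewrite !(leq_trans (size_scale_leq _ _)) ?size_polyXn//= ltnS leq_pred.
Qed.

(** The left-hand side [h] has degree less than [k], and by symmetry of the
    operator it is orthogonal to every polynomial of degree less than [k], in
    particular to itself. *)
Lemma jacobi_equation k :
  jacobi_op s q (P k) + (k%:R * (k%:R + s)) *: P k = 0.
Proof.
set h := _ + _.
have sh : (size h <= k)%N by exact: size_jacobi_op_lead.
have Lhh : L (h * h) = 0.
  rewrite {1}/h mulrDl raddfD /= jacobi_op_symmetric -scalerAl [L (_ *: _)]linearZ /=.
  rewrite !orthogonal_lower_degree ?mulr0 ?addr0//.
  exact: leq_trans (size_jacobi_op _) sh.
apply/eqP; apply: contraTT isT => h0.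
suff /(L_neq0 (mulf_neq0 h0 h0)) : forall x, -1 < x < 1 -> 0 <= (h * h).[x].
  by rewrite Lhh eqxx.
by move=> x _; rewrite hornerM -expr2 sqr_ge0.
Qed.
End JacobiOperator.
End OrthogonalPolynomials.

(** * Integrals with singular endpoints *)

Section ImproperFTC.
Variable K : realType.
Notation mu := (@lebesgue_measure K).
Local Open Scope classical_set_scope.
Local Open Scope ring_scope.

Lemma nondecreasing_of_ge0_is_derive (a b : K) (f F : K -> K) :
  a <= b -> (forall x, x \in `]a, b[ -> is_derive x 1 F (f x)) ->
  (forall x, x \in `]a, b[ -> 0 <= f x) ->
  {within `[a, b], continuous F} -> F a <= F b.
Proof.
rewrite le_eqVlt => /predU1P[->//|ab] dF f0 cF.
have [c cab FE] := MVT ab dF cF.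
by rewrite -subr_ge0 FE mulr_ge0 ?f0// subr_ge0 ltW.
Qed.

(** By monotone convergence on compact subintervals, on which the integrals are
    increments of [F] and hence bounded by [F b - F a]. *)
Lemma improper_ge0_integrable (a b : K) (f F : K -> K) : a < b ->
  {in `]a, b[, continuous f} -> (forall x, x \in `]a, b[ -> 0 <= f x) ->
  {within `[a, b], continuous F} ->
  (forall x, x \in `]a, b[ -> is_derive x 1 F (f x)) ->
  mu.-integrable `[a, b] (EFin \o f).
Proof.
move=> ab cf f0 cF dF.
have moo : measurable_fun `]a, b[ f.
  apply: open_continuous_measurable_fun; first exact: interval_open.
  by move=> x; rewrite inE; exact: cf.
apply/integrableP; split.
  by apply/measurable_EFinP/measurable_fun_itv_bndo_bndcP/measurable_fun_itv_obnd_cbndP.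
rewrite integral_itv_bndoo; last by apply: measurableT_comp => //; exact/measurable_EFinP.
pose E n := `[a + n.+1%:R^-1, b - n.+1%:R^-1]%classic.
have Eab n x : E n x -> x \in `]a, b[.
  rewrite /E/= !in_itv/= => /andP[ax xb]; have n0 : (0 : K) < n.+1%:R^-1 by [].
  by rewrite (lt_le_trans _ ax) ?ltrDl// (le_lt_trans xb)// gtrBl.
have abE : `]a, b[%classic = \bigcup_n E n.
  apply/seteqP; split => [x /= xab|x [n _]]; last exact: Eab.
  have [ax xb] : a < x /\ x < b by move: xab; rewrite in_itv/= => /andP[].
  pose d := Num.min (x - a) (b - x).
  have d0 : 0 < d by rewrite lt_min !subr_gt0 ax xb.
  exists (Num.truncn d^-1) => //.
  have nd : (Num.truncn d^-1).+1%:R^-1 <= d.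
    by rewrite -[leRHS]invrK lef_pV2 ?posrE ?ltr0n ?invr_gt0// ltW// truncnS_gt.
  rewrite /E/= in_itv/=; move: nd; rewrite le_min => /andP[h1 h2].
  by rewrite -lerBrDl h1 lerBrDr -lerBrDl.
rewrite abE.
have ndE : nondecreasing_seq E.
  move=> m n mn; apply/subsetPset; apply: subset_itv; rewrite bnd_simp.
    by rewrite lerD2l lef_pV2 ?posrE ?ltr0n// ler_nat.
  by rewrite lerB// lef_pV2 ?posrE ?ltr0n// ler_nat.
have cv : (\int[mu]_(x in E i) `|(EFin \o f) x| @[i --> \oo]
    --> \int[mu]_(x in \bigcup_i E i) `|(EFin \o f) x|)%E.
  apply: ge0_nondecreasing_set_cvg_integral => // n.
    exact: measurable_itv.
  apply: measurableT_comp => //; apply/measurable_EFinP.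
  by apply: measurable_funS moo => // x; exact: Eab.
rewrite -(cvg_lim _ cv)//; apply: le_lt_trans (ltry (F b - F a)).
apply: lime_le; first exact: cvgP cv.
apply: nearW => n.
have ndF u v : a <= u -> u <= v -> v <= b -> F u <= F v.
  move=> au uv vb; have sub x : x \in `]u, v[ -> x \in `]a, b[.
    by rewrite !in_itv/= => /andP[ux xv]; rewrite (le_lt_trans au) ?(lt_le_trans xv).
  have cFuv : {within `[u, v], continuous F}.
    apply: continuous_subspaceW cF => x /=; rewrite !in_itv/= => /andP[ux xv].
    by rewrite (le_trans au)//= (le_trans xv).
  exact: (nondecreasing_of_ge0_is_derive uv (fun x xuv => dF x (sub x xuv))
    (fun x xuv => f0 x (sub x xuv)) cFuv).
have Fab : F a <= F b by rewrite ndF// ltW.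
have [En|En] := leP (b - n.+1%:R^-1) (a + n.+1%:R^-1).
  suff -> : (\int[mu]_(x in E n) `|(EFin \o f) x| = 0)%E by rewrite lee_fin subr_ge0.
  move: En; rewrite le_eqVlt => /predU1P[En|En].
    by rewrite /E En set_itv1 integral_set1.
  by rewrite /E set_itv_ge ?integral_set0// bnd_simp -ltNge.
have sub : `[a + n.+1%:R^-1, b - n.+1%:R^-1] `<=` `[a, b].
  by move=> x /Eab; exact: subset_itv_oo_cc.
have aE : a + n.+1%:R^-1 \in `]a, b[ by apply: (Eab n); rewrite /E/= in_itv/= lexx ltW.
have bE : b - n.+1%:R^-1 \in `]a, b[ by apply: (Eab n); rewrite /E/= in_itv/= lexx ltW.
have cFE : {within `[a + n.+1%:R^-1, b - n.+1%:R^-1], continuous F}.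
  exact: continuous_subspaceW cF.
have inE x : x \in `]a + n.+1%:R^-1, b - n.+1%:R^-1[ -> x \in `]a, b[.
  by move=> /subset_itv_oo_cc /Eab.
have -> : (\int[mu]_(x in E n) `|(EFin \o f) x| = \int[mu]_(x in E n) (f x)%:E)%E.
  by apply: eq_integral => x /set_mem /Eab /f0 fx0; rewrite /= ger0_norm.
rewrite (@continuous_FTC2 _ f F _ _ En).
- rewrite -EFinB lee_fin.
  move: aE bE; rewrite !in_itv/= => /andP[/ltW a1 /ltW a2] /andP[/ltW b1 /ltW b2].
  by rewrite lerB// ndF.
- by apply: continuous_in_subspaceT => x /set_mem /Eab; exact: cf.
- have := (continuous_within_itvP _ En).1 cFE => -[_ Fl Fr]; split => //.
  by move=> x /inE xab; have [] := dF x xab.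
- by move=> x /inE xab; have dFx := dF x xab; rewrite derive1E derive_val.
Qed.

(** Unlike in [continuous_FTC2], [f] may be unbounded at the endpoints: the
    integral up to [x] is still continuous in [x], and its difference with [F]
    has derivative zero. *)
Lemma improper_FTC (a b : K) (f F : K -> K) : a < b ->
  mu.-integrable `[a, b] (EFin \o f) ->
  {in `]a, b[, continuous f} -> {within `[a, b], continuous F} ->
  (forall x, x \in `]a, b[ -> is_derive x 1 F (f x)) ->
  \int[mu]_(x in `[a, b]) f x = F b - F a.
Proof.
move=> ab intf cf cF dF.
pose G x := parameterized_integral mu a x f.
have cG : {within `[a, b], continuous G}.
  exact: parameterized_integral_continuous (ltW ab) intf.
have dGF x : x \in `]a, b[ -> is_derive x 1 (G - F) 0.
  move=> xab; move: (xab); rewrite in_itv/= => /andP[ax xb].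
  have [dG G'] := continuous_FTC1_closed xb intf ax (cf _ xab).
  have dGx : is_derive x 1 G (f x).
    by apply: DeriveDef; [exact: dG|rewrite -derive1E].
  have dFx := dF _ xab.
  by apply: is_derive_eq (is_deriveB _ _) _; rewrite subrr.
have cGF : {within `[a, b], continuous (G - F)}.
  by move=> x; apply: cvgB; [exact: cG|exact: cF].
have [c _] := MVT ab dGF cGF.
rewrite mul0r !fctE /G /parameterized_integral set_itv1 Rintegral_set1.
by lra.
Qed.
End ImproperFTC.

(** * The moment functional of the Jacobi weight *)

Section JacobiWeight.
Variables (K : realType).
Notation mu := (@lebesgue_measure K).
Local Open Scope classical_set_scope.
Local Open Scope ring_scope.

Lemma powR_cvg_right0 (e : K) : 0 < e -> (1 + x) `^ e @[x --> (-1)^'+] --> (0 : K).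
Proof.
move=> e0; apply/cvgrPdist_lt => eps eps0; near=> x.
rewrite sub0r normrN ger0_norm ?powR_ge0//.
have -> : eps = (eps `^ e^-1) `^ e.
  by rewrite -powRrM mulVf ?lt0r_neq0// powRr1// ltW.
apply: gt0_ltr_powR => //; rewrite ?nnegrE ?powR_ge0//.
  by rewrite -lerBlDl sub0r; apply: ltW; near: x; exact: nbhs_right_gt.
by rewrite -ltrBrDl; near: x; apply: nbhs_right_lt; rewrite ltrBrDl subrr powR_gt0.
Unshelve. all: by end_near. Qed.

Lemma powR_cvg_left0 (e : K) : 0 < e -> (1 - x) `^ e @[x --> 1^'-] --> (0 : K).
Proof.
move=> e0; apply/cvgrPdist_lt => eps eps0; near=> x.
rewrite sub0r normrN ger0_norm ?powR_ge0//.
have -> : eps = (eps `^ e^-1) `^ e.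
  by rewrite -powRrM mulVf ?lt0r_neq0// powRr1// ltW.
apply: gt0_ltr_powR => //; rewrite ?nnegrE ?powR_ge0//.
  by rewrite subr_ge0; apply: ltW; near: x; exact: nbhs_left_lt.
rewrite ltrBlDr -ltrBlDl; near: x; apply: nbhs_left_gt.
by rewrite ltrBlDl ltrDr powR_gt0.
Unshelve. all: by end_near. Qed.

Lemma is_derive_powR_right (e x : K) : -1 < x ->
  is_derive x 1 (fun y : K => (1 + y) `^ e) (e * (1 + x) `^ (e - 1)).
Proof.
move=> x1; have x0 : 0 < 1 + x by lra.
have d1 : is_derive x 1 (fun y : K => 1 + y) 1.
  by apply: is_derive_eq (is_deriveD _ _) _; rewrite add0r.
have := @is_derive1_comp K (@powR K ^~ e) (fun y => 1 + y) x _ _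
  (is_derive1_powR e x0) d1.
by rewrite mulr1.
Qed.

Lemma is_derive_powR_left (e x : K) : x < 1 ->
  is_derive x 1 (fun y : K => (1 - y) `^ e) (- (e * (1 - x) `^ (e - 1))).
Proof.
move=> x1; have x0 : 0 < 1 - x by lra.
have d1 : is_derive x 1 (fun y : K => 1 - y) (- 1).
  by apply: is_derive_eq (is_deriveB _ _) _; rewrite sub0r.
have := @is_derive1_comp K (@powR K ^~ e) (fun y => 1 - y) x _ _
  (is_derive1_powR e x0) d1.
by rewrite mulrN1.
Qed.

Let is_derive_continuous (f : K -> K) (x df : K) :
  is_derive x 1 f df -> {for x, continuous f}.
Proof. by move=> [dfx _]; exact/differentiable_continuous/derivable1_diffP. Qed.

Lemma continuous_powR_right (e : K) : 0 < e ->
  {within `[-1, 1], continuous (fun x : K => (1 + x) `^ e)}.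
Proof.
move=> e0; apply/continuous_within_itvP; first lra; split.
- move=> x; rewrite in_itv/= => /andP[x1 _].
  exact: is_derive_continuous (is_derive_powR_right e x1).
- by rewrite subrr powR0 ?gt_eqF//; exact: powR_cvg_right0.
- apply: cvg_at_left_filter.
  have lt11 : -1 < 1 :> K by lra.
  exact: (is_derive_continuous (is_derive_powR_right e lt11)).
Qed.

Lemma continuous_powR_left (e : K) : 0 < e ->
  {within `[-1, 1], continuous (fun x : K => (1 - x) `^ e)}.
Proof.
move=> e0; apply/continuous_within_itvP; first lra; split.
- move=> x; rewrite in_itv/= => /andP[_ x1].
  exact: is_derive_continuous (is_derive_powR_left e x1).
- apply: cvg_at_right_filter.
  have lt11 : -1 < 1 :> K by lra.
  exact: (is_derive_continuous (is_derive_powR_left e lt11)).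
- by rewrite subrr powR0 ?gt_eqF//; exact: powR_cvg_left0.
Qed.

Let oo11 (x : K) : x \in `]-1, 1[ -> -1 < x /\ x < 1.
Proof. by rewrite in_itv/= => /andP. Qed.

(** The factor [e + 1] makes the integrand the derivative of a power. *)
Lemma integrable_powR_right (e : K) : -1 < e ->
  mu.-integrable `[-1, 1] (EFin \o (fun x : K => (e + 1) * (1 + x) `^ e)).
Proof.
move=> e1; have e0 : 0 < e + 1 by lra.
apply: (@improper_ge0_integrable _ _ _ _ (fun x => (1 + x) `^ (e + 1))).
- by lra.
- move=> x /oo11[x1 _]; apply: cvgM; first exact: cvg_cst.
  exact: is_derive_continuous (is_derive_powR_right e x1).
- by move=> x _; rewrite mulr_ge0 ?powR_ge0// ltW.
- exact: continuous_powR_right.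
- by move=> x /oo11[x1 _]; have := is_derive_powR_right (e + 1) x1; rewrite addrK.
Qed.

Lemma integrable_powR_left (e : K) : -1 < e ->
  mu.-integrable `[-1, 1] (EFin \o (fun x : K => (e + 1) * (1 - x) `^ e)).
Proof.
move=> e1; have e0 : 0 < e + 1 by lra.
apply: (@improper_ge0_integrable _ _ _ _ (- (fun x => (1 - x) `^ (e + 1)))).
- by lra.
- move=> x /oo11[_ x1]; apply: cvgM; first exact: cvg_cst.
  exact: is_derive_continuous (is_derive_powR_left e x1).
- by move=> x _; rewrite mulr_ge0 ?powR_ge0// ltW.
- by move=> x; apply: cvgN; exact: continuous_powR_left.
- move=> x /oo11[_ x1]; have d := is_derive_powR_left (e + 1) x1.
  by apply: is_derive_eq (is_deriveN d) _; rewrite opprK addrK.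
Qed.

Section Moments.
Variables (alpha beta : K).
Hypotheses (halpha : -1 < alpha) (hbeta : -1 < beta).

Let a0 : 0 < alpha + 1. Proof. by rewrite -ltrBlDr sub0r. Qed.
Let b0 : 0 < beta + 1. Proof. by rewrite -ltrBlDr sub0r. Qed.

Let bounded_on (f : K -> K) (M : K) :
  (forall x, x \in `[-1, 1] -> `|f x| <= M) -> [bounded f x | x in `[(-1 : K), 1]].
Proof.
move=> fM; exists M; split=> [|N MN x /= /fM fx]; first exact: num_real.
exact: le_trans (ltW MN).
Qed.

Let mpow_left (e : K) : measurable_fun `[(-1 : K), 1] (fun x : K => (1 - x) `^ e).
Proof.
apply: (measurableT_comp (measurable_powR e)).
by apply: measurable_funB => //; exact: measurable_cst.
Qed.

Let mpow_right (e : K) : measurable_fun `[(-1 : K), 1] (fun x : K => (1 + x) `^ e).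
Proof.
apply: (measurableT_comp (measurable_powR e)).
by apply: measurable_funD => //; exact: measurable_cst.
Qed.

(** Multiplying the weight by [2 = (1 - x) + (1 + x)] splits it into two
    summands, each of which is singular at a single endpoint. *)
Lemma jacobi_weight_integrable :
  mu.-integrable `[-1, 1] (EFin \o jacobi_weight alpha beta).
Proof.
pose h1 x := (2 * (beta + 1))^-1 * (1 - x) `^ (alpha + 1).
pose h2 x := (2 * (alpha + 1))^-1 * (1 + x) `^ (beta + 1).
have h_le (e e' y : K) : 0 < e -> 0 < e' -> 0 <= y <= 2 ->
    `|(2 * e')^-1 * y `^ e| <= (2 * e')^-1 * 2 `^ e.
  move=> e0 e'0 /andP[y0 y2].
  rewrite ger0_norm ?mulr_ge0 ?powR_ge0 ?invr_ge0 ?mulr_ge0 ?(ltW e'0)//.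
  rewrite ler_wpM2l ?invr_ge0 ?mulr_ge0 ?(ltW e'0)//.
  by rewrite ge0_ler_powR ?nnegrE ?(ltW e0).
have i1 : mu.-integrable `[-1, 1] (EFin \o
   (fun x => h1 x * ((beta + 1) * (1 + x) `^ beta))).
  apply: (@integrableMr _ _ _ mu _ _ h1 _ _ _ (integrable_powR_right hbeta)) => //.
    by apply: measurable_funM => //; exact: mpow_left.
  apply: bounded_on => x; rewrite in_itv/= => /andP[x1 x2].
  by apply: h_le => //; lra.
have i2 : mu.-integrable `[-1, 1] (EFin \o
   (fun x => h2 x * ((alpha + 1) * (1 - x) `^ alpha))).
  apply: (@integrableMr _ _ _ mu _ _ h2 _ _ _ (integrable_powR_left halpha)) => //.
    by apply: measurable_funM => //; exact: mpow_right.
  apply: bounded_on => x; rewrite in_itv/= => /andP[x1 x2].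
  by apply: h_le => //; lra.
apply: eq_integrable (integrableD _ i1 i2) => // x /set_mem/=.
rewrite in_itv/= => /andP[x1 x2]; rewrite -EFinD /jacobi_weight /h1 /h2; congr EFin.
rewrite -(@mulr_powRB1 _ (1 - x) (alpha + 1)) ?subr_ge0// addrK.
rewrite -(@mulr_powRB1 _ (1 + x) (beta + 1)) ?addrK//; last by lra.
by field; rewrite !gt_eqF.
Qed.

Lemma jacobi_moment_integrable (p : {poly K}) :
  mu.-integrable `[-1, 1] (EFin \o (fun x => p.[x] * jacobi_weight alpha beta x)).
Proof.
have [M pM] := poly_itv_bound p (-1) 1.
apply: (@integrableMr _ _ _ mu _ _ (horner p) _ _ _ jacobi_weight_integrable) => //.
  by apply: measurable_funTS; apply: continuous_measurable_fun; exact: continuous_horner.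
by apply: bounded_on => x; rewrite in_itv/=; exact: pM.
Qed.

Definition jacobi_moment (p : {poly K}) : K :=
  \int[mu]_(x in `[-1, 1]) (p.[x] * jacobi_weight alpha beta x).

Lemma jacobi_moment_scalar : scalar jacobi_moment.
Proof.
move=> c p r; rewrite /jacobi_moment.
have ic : mu.-integrable `[-1, 1]
    (EFin \o (fun x => c * (p.[x] * jacobi_weight alpha beta x))).
  rewrite (_ : (fun x => _) = fun x => (c *: p).[x] * jacobi_weight alpha beta x).
    exact: jacobi_moment_integrable.
  by apply/funext => x; rewrite hornerZ mulrA.
rewrite -RintegralZl//; last exact: jacobi_moment_integrable.
rewrite -RintegralD//; last exact: jacobi_moment_integrable.
by apply: eq_Rintegral => x _ /=; rewrite hornerD hornerZ mulrDl -mulrA.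
Qed.

(** The integrand is the derivative of [(1 - x^2) w p], which vanishes at both
    endpoints. *)
Lemma jacobi_moment_pearson (p : {poly K}) :
  jacobi_moment ((1 - 'X ^+ 2) * p^`() -
    ((alpha - beta)%:P + (alpha + beta + 1 + 1)%:P * 'X) * p) = 0.
Proof.
pose F := (fun x : K => (1 - x) `^ (alpha + 1)) * (fun x : K => (1 + x) `^ (beta + 1))
          * horner p.
transitivity (F 1 - F (-1)); last first.
  rewrite /F !fctE !subrr !powR0 ?gt_eqF//.
  by ring.
apply: improper_FTC.
- by lra.
- exact: jacobi_moment_integrable.
- move=> x /oo11[x1 x2]; apply: cvgM; first exact: continuous_horner.
  apply: cvgM.
  + exact: is_derive_continuous (is_derive_powR_left alpha x2).
  + exact: is_derive_continuous (is_derive_powR_right beta x1).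
- move=> x; apply: cvgM; first apply: cvgM.
  + exact: continuous_powR_left.
  + exact: continuous_powR_right.
  + by apply: continuous_subspaceT; exact: continuous_horner.
- move=> x /oo11[x1 x2].
  have d1 := is_derive_powR_left (alpha + 1) x2.
  have d2 := is_derive_powR_right (beta + 1) x1.
  apply: is_derive_eq (is_deriveM (is_deriveM d1 d2) (is_derive_poly p x)) _.
  rewrite !addrK !(hornerD, hornerN, hornerM, hornerX, hornerXn, hornerC) /jacobi_weight.
  rewrite !fctE -(@mulr_powRB1 _ (1 - x) (alpha + 1)) ?addrK; [|by lra|exact: a0].
  rewrite -(@mulr_powRB1 _ (1 + x) (beta + 1)) ?addrK; [|by lra|exact: b0].
  by rewrite /GRing.scale /=; ring.
Qed.

(** Otherwise the integrand would vanish almost everywhere, so that ]-1, 1[ would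
    be covered by a null set and the finitely many roots of [p]. *)
Lemma jacobi_moment_neq0 (p : {poly K}) : p != 0 ->
  (forall x, -1 < x < 1 -> 0 <= p.[x]) -> jacobi_moment p != 0.
Proof.
move=> p0 pge0; apply/eqP => mp0.
pose g x := p.[x] * jacobi_weight alpha beta x.
have ig := jacobi_moment_integrable p.
have mg : measurable_fun `](-1 : K), 1[ (EFin \o g).
  have mg' : measurable_fun `[(-1 : K), 1] (EFin \o g) by exact: (measurable_int mu).
  by apply: measurable_funS mg' => //; exact: subset_itv_oo_cc.
have Ig0 : (\int[mu]_(x in `](-1)%R, 1%R[) `|(g x)%:E| = 0)%E.
  have Icc0 : (\int[mu]_(x in `[(-1)%R, 1%R]) (g x)%:E = 0)%E.
    by rewrite -(fineK (integrable_fin_num _ ig))//; congr EFin.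
  rewrite -Icc0 [RHS]integral_itv_bndoo//.
  apply: eq_integral => x /set_mem/= /oo11[x1 x2].
  rewrite /= ger0_norm// mulr_ge0 ?pge0 ?x1//.
  by rewrite mulr_ge0 ?powR_ge0.
have [rs [h [pE rs11 hr]]] := split_roots_in_interval p0.
have [N [mN N0 gN]] := (ae_eq_integral_abs mu (measurable_itv _) mg).1 Ig0.
have sub : `]-1, 1[ `<=` N `|` [set` rs].
  move=> x /= x11; have [x1 x2] := oo11 x11.
  have [xrs|xrs] := boolP (x \in rs); [by right|left].
  apply: gN => /= /(_ x11) [] /eqP; apply/negP.
  have w0 : 0 < jacobi_weight alpha beta x.
    by rewrite mulr_gt0 ?powR_gt0//; lra.
  rewrite mulf_neq0 ?(lt0r_neq0 w0)// pE hornerM mulf_neq0//.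
    by rewrite -rootE hr// x1.
  by rewrite -rootE root_prod_XsubC.
have crs : countable [set` rs] by apply: finite_set_countable; exact: finite_seq.
have rs0 : mu [set` rs] = 0%E by exact: countable_lebesgue_measure0.
have mrs : measurable ([set` rs] : set K).
  by apply: countable_measurable => // t; exact: measurable_set1.
pose I : set K := `](-1 : K), 1[%classic; pose M : set K := N `|` [set` rs].
have : (mu I <= mu M)%E.
  apply: le_measure => //; rewrite ?inE; first exact: measurable_itv.
  exact: measurableU.
rewrite /M measureU0// /I.
rewrite N0 lebesgue_measure_itv/= lte_fin ifT; last by lra.
by rewrite -EFinB lee_fin; lra.
Qed.
End Moments.
End JacobiWeight.

(** * Extreme zeros of Jacobi polynomials *)

Section ExtremeZeros.
Variable K : realType.

Lemma extreme_zero_jacobi (s q lam c : K) (p : {poly K}) (rs : seq K) (z : K) :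
  `|q| < s + 1 -> c != 0 -> p = c *: \prod_(y <- rs) ('X - y%:P) ->
  jacobi_op s q p + lam *: p = 0 -> z \in rs ->
  (forall y, y \in rs -> -1 < y <= z) -> z < 1 ->
  exists2 x, z < x < 1 &
    4 * (1 - x ^+ 2) ^+ 2 <=
    (x - z) ^+ 2 * (4 * lam * (1 - x ^+ 2) - (q + (s + 1) * x) ^+ 2).
Proof.
move=> qs c0 pE ode zrs hrs z1; apply: (extreme_zero_ineq qs zrs hrs z1).
apply: (scalerI c0); rewrite scaler0 -[RHS]ode pE /jacobi_op !derivZ -!mul_polyC.
by ring.
Qed.

Lemma jacobi_op_reflect (s q : K) (p : {poly K}) :
  jacobi_op s (- q) (p \Po - 'X) = jacobi_op s q p \Po - 'X.
Proof.
have d (u : {poly K}) : (u \Po - 'X)^`() = - (u^`() \Po - 'X).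
  by rewrite deriv_comp derivN derivX mulrN1.
rewrite /jacobi_op d derivN d opprK.
rewrite !(rmorphB, rmorphD, rmorphM, rmorphXn, rmorph1) /= !comp_polyX !comp_polyC.
by rewrite polyCN; ring.
Qed.

Lemma prodXsubC_reflect (rs : seq K) :
  (\prod_(y <- rs) ('X - y%:P)) \Po - 'X =
  (-1) ^+ size rs *: \prod_(y <- map -%R rs) ('X - y%:P).
Proof.
elim: rs => [|y rs IH]; first by rewrite !big_nil scale1r rmorph1.
rewrite big_cons comp_polyM IH /= big_cons comp_polyB comp_polyX comp_polyC polyCN.
by rewrite exprS -!mul_polyC polyCM polyCN polyC1; ring.
Qed.

(** The quadratic has roots [y1] and [y2]; it is negative at [1] and [-1], so
    these points are outside [y1, y2], and as [|y1 + y2| < 2] both of [y1], [y2]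
    are between them. *)
Lemma jacobi_turning_points (s q r : K) : `|q| < s + 1 -> s ^+ 2 < r ^+ 2 ->
  let A := r ^+ 2 + 2 * s + 1 in
  let R := Num.sqrt ((r ^+ 2 - q ^+ 2 + 2 * s + 1) * (r ^+ 2 - s ^+ 2)) in
  let y1 := - ((R + q * (s + 1)) / A) in
  let y2 := (R - q * (s + 1)) / A in
  [/\ 0 < A, -1 < y1, y1 < y2, y2 < 1 &
   forall t, (r ^+ 2 - s ^+ 2) * (1 - t ^+ 2) - (q + (s + 1) * t) ^+ 2 =
     A * (y2 - t) * (t - y1)].
Proof.
rewrite ltr_norml => /andP[qs1 qs2] rs A R y1 y2.
have A0 : 0 < A by rewrite /A; nra.
have rad0 : 0 < r ^+ 2 - q ^+ 2 + 2 * s + 1 by nra.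
have R0 : 0 < R by rewrite sqrtr_gt0 mulr_gt0// subr_gt0.
have R2 : R ^+ 2 = (r ^+ 2 - q ^+ 2 + 2 * s + 1) * (r ^+ 2 - s ^+ 2).
  by rewrite sqr_sqrtr// ltW// mulr_gt0// subr_gt0.
have quad t : (r ^+ 2 - s ^+ 2) * (1 - t ^+ 2) - (q + (s + 1) * t) ^+ 2 =
     A * (y2 - t) * (t - y1).
  have -> : A * (y2 - t) * (t - y1) =
      (R ^+ 2 - (q * (s + 1) + A * t) ^+ 2) / A.
    by rewrite /y1 /y2; field; rewrite gt_eqF.
  by rewrite R2 /A; field; rewrite gt_eqF.
have y12 : y1 < y2.
  rewrite -subr_gt0 (_ : y2 - y1 = 2 * R / A) ?divr_gt0 ?mulr_gt0//.
  by rewrite /y1 /y2; field; rewrite gt_eqF.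
have sum : A * (y1 + y2) = - 2 * q * (s + 1) by rewrite /y1 /y2; field; rewrite gt_eqF.
have : `|q * (s + 1)| < A by rewrite ltr_norml /A; apply/andP; split; nra.
rewrite ltr_norml => /andP[lo hi].
have sum2 : -2 < y1 + y2 < 2.
  by apply/andP; split; rewrite -(ltr_pM2l A0) sum; lra.
have neg1 : 0 < (1 - y2) * (1 - y1).
  have sq : 0 < (q + (s + 1)) ^+ 2 by rewrite exprn_gt0//; lra.
  rewrite -(pmulr_rgt0 _ A0); move: (quad 1).
  by rewrite expr1n subrr mulr0 mulr1; lra.
have negN1 : 0 < (1 + y2) * (1 + y1).
  have sq : 0 < (s + 1 - q) ^+ 2 by rewrite exprn_gt0//; lra.
  rewrite -(pmulr_rgt0 _ A0); move: (quad (-1)).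
  by rewrite sqrrN expr1n subrr mulr0 mulrN1; lra.
have /andP[sl sh] := sum2.
split=> //.
- by rewrite ltNge; apply/negP => y1l; nra.
- by rewrite ltNge; apply/negP => y2l; nra.
Qed.

End ExtremeZeros.

Lemma jacobi_polynomial_structure (K : realType) (alpha beta : K) (k : nat)
    (P : nat -> {poly K}) : -1 < alpha -> -1 < beta -> jacobi_polynomials alpha beta P ->
  let lam := k%:R * (k%:R + (alpha + beta + 1)) in
  jacobi_op (alpha + beta + 1) (alpha - beta) (P k) + lam *: P k = 0 /\
  exists c rs, [/\ c != 0, P k = c *: \prod_(z <- rs) ('X - z%:P) &
    forall z, z \in rs -> -1 < z < 1].
Proof.
move=> ha hb [sizeP orthP] lam.
pose L : {scalar {poly K}} := HB.pack (jacobi_moment alpha beta)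
  (GRing.isLinear.Build K {poly K} K *%R _ (jacobi_moment_scalar ha hb)).
have L_neq0 (p : {poly K}) : p != 0 -> (forall x, -1 < x < 1 -> 0 <= p.[x]) -> L p != 0.
  exact: jacobi_moment_neq0.
have L_orth m n : m <> n -> L (P m * P n) = 0.
  move=> mn; rewrite /L /= /jacobi_moment /Rintegral.
  under eq_integral do rewrite hornerM.
  by rewrite orthP.
split; last exact: orthogonal_roots_in_interval L_neq0 sizeP L_orth k.
apply: (jacobi_equation L_neq0 sizeP L_orth) => p.
exact: jacobi_moment_pearson.
Qed.

Theorem theorem7 (K : realType) (alpha beta : K) (k : nat)
    (P : nat -> {poly K}) (xm xM : K)
    (hbeta : -1 < beta) (halpha : beta <= alpha) (hk : (1 <= k)%N)
    (hP : jacobi_polynomials alpha beta P)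
    (hxm : least_zero (P k) xm) (hxM : largest_zero (P k) xM) :
  let s : K := alpha + beta + 1 in
  let q : K := alpha - beta in
  let r : K := 2 * k%:R + alpha + beta + 1 in
  let R : K :=
    Num.sqrt ((r ^+ 2 - q ^+ 2 + 2 * s + 1) * (r ^+ 2 - s ^+ 2)) in
  let y1 : K := - ((R + q * (s + 1)) / (r ^+ 2 + 2 * s + 1)) in
  let y2 : K := (R - q * (s + 1)) / (r ^+ 2 + 2 * s + 1) in
  y1 + 3 * (1 - y1 ^+ 2) `^ (2 / 3) * (2 * R) `^ (- (1 / 3)) < xm /\
  xM < y2 - 3 * (1 - y2 ^+ 2) `^ (2 / 3) * (2 * R) `^ (- (1 / 3))
       + 4 * q * (s + 1) / (r ^+ 2 + 2 * s + 1) `^ (3 / 2).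
Proof.
move=> s q r R y1 y2; set A := r ^+ 2 + 2 * s + 1.
have ha : -1 < alpha by exact: lt_le_trans halpha.
have [ode [c [rs [c0 PE rs11]]]] := jacobi_polynomial_structure k ha hbeta hP.
set lam := _ * _ in ode.
have s1 : 0 < s + 1 by rewrite /s; lra.
have q0 : 0 <= q by rewrite subr_ge0.
have qs : `|q| < s + 1 by rewrite ger0_norm// /q /s; lra.
have lamE : 4 * lam = r ^+ 2 - s ^+ 2 by rewrite /lam /r /s; ring.
have k1 : 1 <= k%:R :> K by rewrite ler1n.
have rs2 : s ^+ 2 < r ^+ 2.
  rewrite -subr_gt0 -lamE /lam mulr_gt0// mulr_gt0 ?(lt_le_trans ltr01 k1)//.
  by rewrite -/s; lra.
have [A0 y1m y12 y21 quad] : [/\ 0 < A, -1 < y1, y1 < y2, y2 < 1 &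
   forall t, (r ^+ 2 - s ^+ 2) * (1 - t ^+ 2) - (q + (s + 1) * t) ^+ 2 =
     A * (y2 - t) * (t - y1)] := jacobi_turning_points qs rs2.
have A_neq0 : A != 0 by rewrite gt_eqF.
have sumE : y1 + y2 = - 2 * q * (s + 1) / A by rewrite /y1 /y2 -/A; field.
have sum0 : y1 + y2 <= 0.
  by rewrite sumE ler_pdivrMr// mul0r !mulNr oppr_le0 !mulr_ge0// ltW.
have diffE : A * (y2 - y1) = 2 * R by rewrite /y1 /y2 -/A; field.
have memP y : root (P k) y = (y \in rs) by rewrite PE rootZ// root_prod_XsubC.
have [[xm0 xmle] [xM0 xMge]] := (hxm, hxM).
split.
(* The least zero is the largest one of the reflected polynomial. *)
- have PE' : P k \Po - 'X =
      (c * (-1) ^+ size rs) *: \prod_(y <- map -%R rs) ('X - y%:P).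
    by rewrite PE comp_polyZ prodXsubC_reflect scalerA.
  have ode' : jacobi_op s (- q) (P k \Po - 'X) + lam *: (P k \Po - 'X) = 0.
    by rewrite jacobi_op_reflect -comp_polyZ -comp_polyD ode comp_poly0.
  have c0' : c * (-1) ^+ size rs != 0 by rewrite mulf_neq0// signr_eq0.
  have qs' : `|- q| < s + 1 by rewrite normrN.
  have xmrs : - xm \in map -%R rs by rewrite map_f// -memP.
  have xmle' y : y \in map -%R rs -> -1 < y <= - xm.
    move=> /mapP[z zrs ->]; rewrite lerN2 xmle ?memP// andbT ltrN2.
    by have /andP[] := rs11 z zrs.
  have xm1 : - xm < 1.
    by rewrite ltrNl; have /andP[] := rs11 xm (etrans (esym (memP xm)) xm0).
  have [x /andP[xmx x1] Hx] := extreme_zero_jacobi qs' c0' PE' ode' xmrs xmle' xm1.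
  have /andP[xmm _] := xmle' _ xmrs.
  rewrite -ltrN2 opprD.
  have := @zero_bound_far _ A (- y2) (- y1) x (- xm) A0.
  have -> : - y1 - - y2 = y2 - y1 by ring.
  rewrite sqrrN diffE; apply.
  + by rewrite x1 andbT (lt_trans xmm).
  + by [].
  + by rewrite ltrN2 y12 ltrNl.
  + by rewrite ltrN2.
  + by lra.
  apply: le_trans Hx _; rewrite lamE.
  have -> : (- q + (s + 1) * x) ^+ 2 = (q + (s + 1) * - x) ^+ 2 by ring.
  by rewrite -[x in 1 - x ^+ 2]opprK sqrrN quad; lra.
- have xMrs : xM \in rs by rewrite -memP.
  have xMge' y : y \in rs -> -1 < y <= xM.
    by move=> yrs; rewrite xMge ?memP// andbT; have /andP[] := rs11 y yrs.
  have /andP[xMm xM1] := rs11 xM xMrs.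
  have [x /andP[xMx x1] Hx] := extreme_zero_jacobi qs c0 PE ode xMrs xMge' xM1.
  have corr : - (2 * (y1 + y2) / Num.sqrt A) = 4 * q * (s + 1) / A `^ (3 / 2).
    have -> : A `^ (3 / 2) = A * Num.sqrt A.
      have -> : 3 / 2 = 1 + 2^-1 :> K by field.
      by rewrite powRD ?A_neq0 ?implybT// powRr1 ?powR12_sqrt// ltW.
    by rewrite sumE; field; rewrite A_neq0 lt0r_neq0// sqrtr_gt0.
  rewrite -corr -diffE.
  apply: (@zero_bound_near _ A y1 y2 x) => //.
  + by rewrite x1 andbT (lt_trans xMm).
  + by rewrite y12.
  by rewrite -quad -lamE.
Qed.
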